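(* Let $r,k\in\mathbb{Z}$ and let $n\ge 1$ be an integer. Then, as polynomials in $x$, $$\begin{aligned}A_{n}^{(r,k)}(x)={}&-xA_{n-1}^{(r,k)}(x+1)+r\sum_{l=0}^{n-1}\sum_{a=0}^{l}(-1)^{n-a}\frac{(n-1-l)!\,(l-a)!}{l-a+2}\binom{n-1}{l}\binom{l}{a}A_{a}^{(r+1,k)}(x)\\&+r\sum_{l=0}^{n-1}(-1)^{n-l-1}(n-l-1)!\binom{n-1}{l}A_{l}^{(r,k)}(x)\\&+\frac{1}{n}\left(A_{n}^{(r+1,k-1)}(x+1)-A_{n}^{(r+1,k)}(x+1)\right).\end{aligned}$$
   Context: All generating functions are formal power series in $t$. For $k\in\mathbb{Z}$, put $\mathrm{Lif}_k(t)=\sum_{n\ge 0}\frac{t^n}{n!(n+1)^k}$. For $r,k\in\mathbb{Z}$, the polynomials $A_n^{(r,k)}(x)\in\mathbb{C}[x]$ are defined by $$\left(\frac{t}{\log(1+t)}\right)^{r}\frac{\mathrm{Lif}_k(\log(1+t))}{(1+t)^{x}}=\sum_{n\ge 0}A_n^{(r,k)}(x)\frac{t^n}{n!}.$$ *)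

(* Defs.v *)
From HB Require Import structures.
From mathcomp Require Import all_boot all_order all_algebra.
From mathcomp Require Import boolp.
From mathcomp Require Export reals.
From mathcomp.real_closed Require Export complex.

Set Implicit Arguments.
Unset Strict Implicit.
Unset Printing Implicit Defensive.

Import GRing.Theory.
Local Open Scope ring_scope.

(* Formal power series in one variable t: the series f is the sum over n of
   coefs f n * t^n. *)
Record fps (A : Type) := Fps { coefs : nat -> A }.

HB.instance Definition _ (A : Type) := gen_eqMixin (fps A).
HB.instance Definition _ (A : Type) := gen_choiceMixin (fps A).

Lemma fpsP (A : Type) (f g : fps A) : coefs f =1 coefs g <-> f = g.
Proof.
split=> [|-> //]; case: f g => [f] [g] /= fg; congr Fps.
exact/funext.
Qed.

Section FpsRing.
Variable A : comNzRingType.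
Implicit Types f g h : fps A.

Definition fps0 : fps A := Fps (fun=> 0).
Definition fps1 : fps A := Fps (fun n => (n == 0)%:R).
Definition fps_opp f : fps A := Fps (fun n => - coefs f n).
Definition fps_add f g : fps A := Fps (fun n => coefs f n + coefs g n).
Definition fps_mul f g : fps A :=
  Fps (fun n => \sum_(i < n.+1) coefs f i * coefs g (n - i)).

Fact fps_addA : associative fps_add.
Proof. by move=> f g h; apply/fpsP => n /=; rewrite addrA. Qed.
Fact fps_addC : commutative fps_add.
Proof. by move=> f g; apply/fpsP => n /=; rewrite addrC. Qed.
Fact fps_add0 : left_id fps0 fps_add.
Proof. by move=> f; apply/fpsP => n /=; rewrite add0r. Qed.
Fact fps_addN : left_inverse fps0 fps_opp fps_add.
Proof. by move=> f; apply/fpsP => n /=; rewrite addNr. Qed.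

HB.instance Definition _ :=
  GRing.isZmodule.Build (fps A) fps_addA fps_addC fps_add0 fps_addN.

Definition fps_trunc n f : {poly A} := \poly_(i < n.+1) coefs f i.

Lemma coef_fps_trunc n f i : (i <= n)%N -> (fps_trunc n f)`_i = coefs f i.
Proof. by move=> le_in; rewrite coef_poly ltnS le_in. Qed.

Lemma fps_mul_poly n f g (p q : {poly A}) :
  (forall i, (i <= n)%N -> p`_i = coefs f i) ->
  (forall i, (i <= n)%N -> q`_i = coefs g i) ->
  forall i, (i <= n)%N -> (p * q)`_i = coefs (fps_mul f g) i.
Proof.
move=> pf qg i le_in; rewrite coefM /=; apply: eq_bigr => j _.
rewrite pf ?qg //; first exact: leq_trans (leq_subr _ _) le_in.
by apply: leq_trans le_in; rewrite -ltnS.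
Qed.

Fact fps_mulA : associative fps_mul.
Proof.
move=> f g h; apply/fpsP => n; have T := @coef_fps_trunc n.
rewrite -(@fps_mul_poly n _ _ (fps_trunc n f) (fps_trunc n g * fps_trunc n h))//.
- rewrite mulrA.
  apply: (@fps_mul_poly n) => // [] i; last exact: T.
  by apply: fps_mul_poly => j; apply: T.
- by move=> i; apply: T.
- by apply: fps_mul_poly => j; apply: T.
Qed.

Fact fps_mulC : commutative fps_mul.
Proof.
move=> f g; apply/fpsP => n; have T := @coef_fps_trunc n.
rewrite -(@fps_mul_poly n f g (fps_trunc n f) (fps_trunc n g)) //; last 2 first.
- by move=> i; apply: T.
- by move=> i; apply: T.
by rewrite mulrC; apply: (@fps_mul_poly n) => // i; apply: T.
Qed.

Fact fps_mul1 : left_id fps1 fps_mul.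
Proof.
move=> f; apply/fpsP => n /=; rewrite big_ord_recl /= mul1r subn0 big1 ?addr0//.
by move=> i _; rewrite mul0r.
Qed.

Fact fps_mulD : left_distributive fps_mul fps_add.
Proof.
move=> f g h; apply/fpsP => n /=; rewrite -big_split /=.
by apply: eq_bigr => i _; rewrite mulrDl.
Qed.

Fact fps1_neq0 : fps1 != 0 :> fps A.
Proof. by apply/eqP => /fpsP /(_ 0)%N /= /eqP; rewrite oner_eq0. Qed.

HB.instance Definition _ := GRing.Zmodule_isComNzRing.Build (fps A)
  fps_mulA fps_mulC fps_mul1 fps_mulD fps1_neq0.

End FpsRing.

Section FpsUnitRing.
Variable A : comUnitRingType.
Implicit Types f g : fps A.

Definition fps_unit : {pred fps A} := fun f => coefs f 0 \is a GRing.unit.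

(* The first n coefficients of the inverse g of f: g_0 = f_0^-1 and
   g_m = - f_0^-1 * (sum over i < m of g_i f_(m - i)) for m > 0. *)
Fixpoint fps_inv_seq f n : seq A :=
  if n is m.+1 then
    let s := fps_inv_seq f m in
    rcons s ((coefs f 0)^-1 *
      ((m == 0)%:R - \sum_(i < m) s`_i * coefs f (m - i)))
  else [::].

Definition fps_inv f : fps A :=
  if f \in fps_unit then Fps (fun n => (fps_inv_seq f n.+1)`_n) else f.

Lemma size_fps_inv_seq f n : size (fps_inv_seq f n) = n.
Proof. by elim: n => //= n IH; rewrite size_rcons IH. Qed.

Lemma nth_fps_inv_seq f n i :
  (i < n)%N -> (fps_inv_seq f n)`_i = (fps_inv_seq f i.+1)`_i.
Proof.
elim: n => // n IH; rewrite ltnS leq_eqVlt => /predU1P[-> //|lt_in].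
by rewrite [in LHS]/= nth_rcons size_fps_inv_seq lt_in IH.
Qed.

Fact fps_mulVx : {in fps_unit, left_inverse 1 fps_inv *%R}.
Proof.
move=> f uf; apply/fpsP => n; rewrite /fps_inv uf.
rewrite [LHS]/= big_ord_recr /= subnn.
rewrite nth_rcons size_fps_inv_seq ltnn eqxx.
rewrite mulrAC mulVr // mul1r.
rewrite (eq_bigr (fun i : 'I_n => (fps_inv_seq f n)`_i * coefs f (n - i))).
  by rewrite addrC subrK.
by move=> i _; rewrite (nth_fps_inv_seq f (ltn_ord i)).
Qed.

Fact fps_unitPl f g : g * f = 1 -> fps_unit f.
Proof.
move=> /fpsP /(_ 0)%N /=; rewrite big_ord1 => gf1.
by apply/unitrP; exists (coefs g 0); split; rewrite // mulrC.
Qed.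

Fact fps_inv_out : {in [predC fps_unit], fps_inv =1 id}.
Proof. by move=> f; rewrite inE /fps_inv => /negPf ->. Qed.

HB.instance Definition _ := GRing.ComNzRing_hasMulInverse.Build (fps A)
  fps_mulVx fps_unitPl fps_inv_out.

End FpsUnitRing.

Definition fpsX (A : comNzRingType) : fps A := Fps (fun n => (n == 1%N)%:R).

Definition fps_divX (A : Type) (f : fps A) : fps A :=
  Fps (fun n => coefs f n.+1).

(* Meaningful only if the constant term of g is 0: then (g^i)_n = 0 for
   i > n, so the truncated sum is the whole one. *)
Definition fps_comp (A : comNzRingType) (f g : fps A) : fps A :=
  Fps (fun n => \sum_(i < n.+1) coefs f i * coefs (g ^+ i) n).

(* Every series has coefficients in F[x], with F embedded as the constant
   polynomials. *)
Section Series.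
Variable F : fieldType.

Definition fps_log1p : fps {poly F} :=
  Fps (fun n => if n is m.+1 then ((-1) ^+ m / m.+1%:R)%:P else 0).

(* The series log(1+t) is not invertible, but log(1+t)/t is: t/log(1+t) is
   the inverse of the latter, and so the quotient of t by log(1+t), see
   [t_div_logK]. *)
Definition t_div_log : fps {poly F} := (fps_divX fps_log1p)^-1.

Definition Lif (k : int) : fps {poly F} :=
  Fps (fun n => ((n`!%:R * n.+1%:R ^ k)^-1)%:P).

(* Binomial series: (1+t)^p has n-th coefficient p(p-1)...(p-n+1)/n!. *)
Definition fps_pow1p (p : {poly F}) : fps {poly F} :=
  Fps (fun n => (n`!%:R^-1 : F) *: \prod_(i < n) (p - i%:R)).

Definition Agf (r k : int) : fps {poly F} :=
  t_div_log ^ r * (fps_comp (Lif k) fps_log1p / fps_pow1p 'X).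

Definition Apol (r k : int) (n : nat) : {poly F} :=
  n`!%:R *: coefs (Agf r k) n.

Lemma fps_log1p_divXK : fpsX _ * fps_divX fps_log1p = fps_log1p.
Proof.
apply/fpsP => -[|n] /=; first by rewrite big_ord1 mul0r.
rewrite big_ord_recl mul0r add0r big_ord_recl /= mul1r subn1 big1 ?addr0 //.
by move=> i _; rewrite mul0r.
Qed.

Lemma fps_log1p_divX_unit : fps_divX fps_log1p \is a GRing.unit.
Proof. by rewrite unfold_in /= /fps_unit /= divr1 unitr1. Qed.

Lemma t_div_logK : t_div_log * fps_log1p = fpsX _.
Proof.
by rewrite -fps_log1p_divXK mulrCA mulVr ?mulr1 ?fps_log1p_divX_unit.
Qed.

Lemma fps_pow1p_unit p : fps_pow1p p \is a GRing.unit.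
Proof.
by rewrite unfold_in /= /fps_unit /= big_ord0 fact0 invr1 scale1r unitr1.
Qed.

End Series.

Arguments Apol {F}.

(* Main.v *)
(** With T = t / log(1+t), let G_(r,k) = T^r Lif_k(log(1+t)) (1+t)^-x be the
    generating function of the A_n^(r,k)(x), and E = t d/dt.  The factors have
    E T = T (1 - T/(1+t)), E (Lif_k(log(1+t))) = T (Lif_(k-1) - Lif_k)(log(1+t)) / (1+t)
    and E (1+t)^-x = -x t (1+t)^-x / (1+t), while x -> x+1 divides G_(r,k) by
    1+t.  Writing log(1+t) = t (1 + t u), so that T (1 + t u) = 1, gives
    1 - T/(1+t) = t (1 + u T) / (1+t), and hence
      E G_(r,k) = - x t G_(r,k)(x+1) + r t (u G_(r+1,k) + G_(r,k)) / (1+t)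
                  + G_(r+1,k-1)(x+1) - G_(r+1,k)(x+1),
    whose n-th coefficients give the identity. *)
From HB Require Import structures.
Require Import Defs.
From mathcomp Require Import all_boot all_order all_algebra.
From mathcomp Require Import ring.
Import GRing.Theory Num.Theory.
Local Open Scope ring_scope.

(** * Coefficients, composition and the Euler operator on formal power series *)

Section FpsTheory.
Set Implicit Arguments.
Unset Strict Implicit.
Variable A : comNzRingType.
Implicit Types f g h : fps A.

Lemma coefsD n f g : coefs (f + g) n = coefs f n + coefs g n.
Proof. by []. Qed.

Lemma coefsN n f : coefs (- f) n = - coefs f n.
Proof. by []. Qed.

Lemma coefsM n f g :
  coefs (f * g) n = \sum_(i < n.+1) coefs f i * coefs g (n - i).
Proof. by []. Qed.

Lemma coefs1 n : coefs (1 : fps A) n = (n == 0)%:R.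
Proof. by []. Qed.

Lemma coefsMrz n f (z : int) : coefs (z%:~R * f) n = z%:~R * coefs f n.
Proof.
have coefsMn m : coefs (f *+ m) n = coefs f n *+ m.
  by elim: m => // m IH; rewrite !mulrS coefsD IH.
by rewrite !mulrzl; case: z => m; rewrite ?NegzE ?mulrNz ?coefsN -!pmulrn coefsMn.
Qed.

Definition fpsC (c : A) : fps A := Fps (fun n => if n is 0 then c else 0).

Lemma coefs_fpsCM n c f : coefs (fpsC c * f) n = c * coefs f n.
Proof.
rewrite coefsM big_ord_recl subn0 big1 ?addr0 // => i _.
by rewrite mul0r.
Qed.

Lemma coefs_fpsXM n f : coefs (fpsX A * f) n.+1 = coefs f n.
Proof.
rewrite coefsM big_ord_recl mul0r add0r big_ord_recl /= mul1r subn1 big1 ?addr0 //.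
by move=> i _; rewrite mul0r.
Qed.

Lemma coefs_fpsXM0 f : coefs (fpsX A * f) 0 = 0.
Proof. by rewrite coefsM big_ord1 mul0r. Qed.

(** The series t is not a unit, so identities that divide by t are proved after multiplication by t
    and then cancelled. *)
Lemma fpsX_lreg : GRing.lreg (fpsX A).
Proof.
by move=> f g /fpsP Xfg; apply/fpsP => n; rewrite -(coefs_fpsXM n f) Xfg coefs_fpsXM.
Qed.

Lemma fps_divXK f : coefs f 0 = 0 -> fpsX A * fps_divX f = f.
Proof.
by move=> f0; apply/fpsP => -[|n]; rewrite ?coefs_fpsXM0 ?coefs_fpsXM.
Qed.

Lemma coefs_fpsXnM i n f : (n < i)%N -> coefs (fpsX A ^+ i * f) n = 0.
Proof.
elim: i n f => // i IH [|n] f ltni; rewrite exprS -mulrA ?coefs_fpsXM0 //.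
by rewrite coefs_fpsXM IH.
Qed.

Lemma coefs_exprM_small i n g h :
  coefs g 0 = 0 -> (n < i)%N -> coefs (g ^+ i * h) n = 0.
Proof.
by move=> /fps_divXK <- ltni; rewrite exprMn -mulrA coefs_fpsXnM.
Qed.

(** As g is divisible by t, the powers g^i with i > n do not reach the n-th coefficient. The
    truncation point can thus be any N >= n, and one common bound lets the two sums be exchanged. *)
Lemma coefs_compM N n f g h : coefs g 0 = 0 -> (n <= N)%N ->
  coefs (fps_comp f g * h) n = \sum_(i < N.+1) coefs f i * coefs (g ^+ i * h) n.
Proof.
move=> g0 lenN.
have widen m : (m <= N)%N ->
    coefs (fps_comp f g) m = \sum_(i < N.+1) coefs f i * coefs (g ^+ i) m.
  move=> lemN; rewrite [LHS]/=.
  rewrite (big_ord_widen N.+1 (fun i => coefs f i * coefs (g ^+ i) m)) //.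
  rewrite big_mkcond; apply: eq_bigr => i _; case: ifP => // /negbT.
  rewrite -leqNgt => ltmi.
  by rewrite -[g ^+ i]mulr1 coefs_exprM_small ?mulr0.
rewrite coefsM.
under eq_bigr => j _.
  rewrite widen ?mulr_suml; last by apply: leq_trans lenN; rewrite -ltnS.
  over.
rewrite exchange_big; apply: eq_bigr => i _.
by rewrite coefsM mulr_sumr; apply: eq_bigr => j _; rewrite mulrA.
Qed.

Lemma fps_comp_divX f g : coefs g 0 = 0 -> coefs f 0 = 0 ->
  fps_comp f g = fps_comp (fps_divX f) g * g.
Proof.
move=> g0 f0; apply/fpsP => n.
(* The left side is cut one term later, since its vanishing term i = 0 is dropped next. *)
rewrite (@coefs_compM n) // -[fps_comp f g]mulr1 (@coefs_compM n.+1) //.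
rewrite big_ord_recl f0 mul0r add0r; apply: eq_bigr => i _.
by rewrite mulr1 exprSr.
Qed.

(** The operator E = t d/dt is a derivation like d/dt, but it shifts no index. *)
Definition fps_euler f : fps A := Fps (fun n => n%:R * coefs f n).

Lemma coefs_euler n f : coefs (fps_euler f) n = n%:R * coefs f n.
Proof. by []. Qed.

Lemma fps_eulerM f g :
  fps_euler (f * g) = fps_euler f * g + f * fps_euler g.
Proof.
apply/fpsP => n; rewrite coefsD !coefsM /= mulr_sumr -big_split.
apply: eq_bigr => i _ /=.
by rewrite -{1}(subnKC (ltn_ord i : (i <= n)%N)) natrD; ring.
Qed.

Lemma fps_euler1 : fps_euler 1 = 0.
Proof. by apply/fpsP => -[|n] /=; rewrite ?mul0r ?mulr0. Qed.

Lemma fps_eulerX g n :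
  fps_euler (g ^+ n.+1) = n.+1%:R * (g ^+ n * fps_euler g).
Proof.
elim: n => [|n IH]; first by rewrite !mul1r.
by rewrite exprS fps_eulerM IH -(natr1 n.+1) exprS; move: (g ^+ n) => h; ring.
Qed.

(** Chain rule E(f(g)) = f'(g) E g, multiplied by g because (E f)(g) = g f'(g). *)
Lemma fps_euler_comp f g : coefs g 0 = 0 ->
  g * fps_euler (fps_comp f g) = fps_comp (fps_euler f) g * fps_euler g.
Proof.
(* E f has constant term 0, so a factor g splits off and leaves f' = (E f)/t. *)
move=> g0; rewrite [in RHS]fps_comp_divX ?mul0r //=; last by rewrite mul0r.
rewrite [_ * g]mulrC -mulrA; congr (_ * _); apply/fpsP => n.
rewrite (@coefs_compM n) // coefs_euler.
rewrite -[fps_comp f g]mulr1 (@coefs_compM n.+1) // mulr_sumr big_ord_recl.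
rewrite mulr1 coefs1 mulrCA.
have -> : n%:R * (n == 0)%:R = 0 :> A by case: n => [|n]; rewrite ?mul0r ?mulr0.
rewrite mulr0 add0r; apply: eq_bigr => i _.
rewrite mulr1 mulrCA.
rewrite -coefs_euler fps_eulerX.
by rewrite -[i.+1%:R]/((i.+1 : int)%:~R) coefsMrz mulrCA mulrA.
Qed.

End FpsTheory.

(** * Ring morphisms applied to coefficients, later the shift x -> x+1 *)

Section FpsMap.
Set Implicit Arguments.
Unset Strict Implicit.
Variables (A B : comNzRingType) (phi : {rmorphism A -> B}).

Definition fps_map (f : fps A) : fps B := Fps (fun n => phi (coefs f n)).

Fact fps_map_is_zmod_morphism : zmod_morphism fps_map.
Proof. by move=> f g; apply/fpsP => n /=; rewrite rmorphB. Qed.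

Fact fps_map_is_monoid_morphism : monoid_morphism fps_map.
Proof.
split=> [|f g]; apply/fpsP => n; first by rewrite /= rmorph_nat.
by rewrite /= rmorph_sum; apply: eq_bigr => i _; rewrite rmorphM.
Qed.

HB.instance Definition _ :=
  GRing.isZmodMorphism.Build (fps A) (fps B) fps_map fps_map_is_zmod_morphism.
HB.instance Definition _ :=
  GRing.isMonoidMorphism.Build (fps A) (fps B) fps_map
    fps_map_is_monoid_morphism.

Lemma fps_map_comp f g :
  fps_map (fps_comp f g) = fps_comp (fps_map f) (fps_map g).
Proof.
apply/fpsP => n /=; rewrite rmorph_sum; apply: eq_bigr => i _.
by rewrite rmorphM -rmorphXn.
Qed.

End FpsMap.

(** * Logarithmic derivatives for E *)

Section LogEuler.
Set Implicit Arguments.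
Unset Strict Implicit.
Variable A : comUnitRingType.
Implicit Types f c : fps A.

(** In E f = f c, the series c is the logarithmic derivative of f. Applying E to f f^-1 = 1 shows
    that inversion negates it. *)
Lemma fps_euler_inv f c : f \is a GRing.unit ->
  fps_euler f = f * c -> fps_euler f^-1 = f^-1 * - c.
Proof.
move=> uf Ef; have := fps_eulerM f f^-1.
rewrite mulrV // fps_euler1 Ef => /(congr1 ( *%R f^-1)).
rewrite mulr0 mulrDr mulKr // => /esym/eqP.
by rewrite addrC addr_eq0 => /eqP ->; rewrite -mulrA mulKr // mulrN mulrC.
Qed.

Lemma fps_euler_exprn f c n :
  fps_euler f = f * c -> fps_euler (f ^+ n) = f ^+ n * (n%:R * c).
Proof.
case: n => [|n] Ef; first by rewrite fps_euler1 mul0r mulr0.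
by rewrite fps_eulerX Ef exprSr; ring.
Qed.

Lemma fps_euler_exprz f c (z : int) : f \is a GRing.unit ->
  fps_euler f = f * c -> fps_euler (f ^ z) = f ^ z * (z%:~R * c).
Proof.
move=> uf Ef; case: z => n; first exact: fps_euler_exprn.
rewrite NegzE -exprnN -exprVn.
rewrite (fps_euler_exprn _ (fps_euler_inv uf Ef)) mulrNz.
by rewrite mulrN mulNr.
Qed.

End LogEuler.

(** * The factors T and Lif_k(log(1+t)) of the generating function *)

Section Agf.
Set Implicit Arguments.
Unset Strict Implicit.
Variable F : numFieldType.
Local Notation S := (fps {poly F}).
Local Notation X := (fpsX {poly F}).
Local Notation log1p := (fps_log1p F).
Local Notation T := (t_div_log F).
Local Notation LL k := (fps_comp (Lif F k) log1p).
Local Notation P := (@fps_pow1p F).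
Local Notation shift := (fps_map (comp_poly ('X + 1 : {poly F}))).

Definition fps_geom : S := Fps (fun n => (-1) ^+ n).

Lemma fps_geomP : (1 + X) * fps_geom = 1.
Proof.
apply/fpsP => -[|n]; rewrite mulrDl mul1r coefsD ?coefs_fpsXM0 ?addr0 //.
by rewrite coefs_fpsXM /= exprS mulN1r addNr.
Qed.

(* The u with log(1+t) = t (1 + t u). *)
Definition log1p_tail : S := Fps (fun n => ((-1) ^+ n.+1 / n.+2%:R)%:P).

Lemma coefs_log1p_tail n :
  coefs log1p_tail n = ((-1) ^+ n.+1 / n.+2%:R)%:P.
Proof. by []. Qed.

Lemma fps_divX_log1p : fps_divX log1p = 1 + X * log1p_tail.
Proof.
apply/fpsP => -[|n]; rewrite coefsD ?coefs_fpsXM0 ?coefs_fpsXM /=.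
  by rewrite expr0 divr1 addr0.
by rewrite add0r.
Qed.

Lemma t_div_log_tail : T * (1 + X * log1p_tail) = 1.
Proof. by rewrite -fps_divX_log1p mulVr // fps_log1p_divX_unit. Qed.

Lemma t_div_log_unit : T \is a GRing.unit.
Proof. by rewrite unitrV fps_log1p_divX_unit. Qed.

Lemma euler_log1p : fps_euler log1p = X * fps_geom.
Proof.
apply/fpsP => -[|n]; rewrite ?coefs_fpsXM0 ?coefs_fpsXM /= ?mul0r //.
rewrite -polyC_natr -polyCM mulrCA mulfV ?pnatr_eq0 // mulr1.
by rewrite rmorphXn rmorphN1.
Qed.

Lemma euler_fpsX : fps_euler X = X.
Proof. by apply/fpsP => -[|[|n]] /=; rewrite ?mulr1 ?mul0r ?mulr0. Qed.

Lemma euler_t_div_log : fps_euler T = T * (1 - T * fps_geom).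
Proof.
apply: fpsX_lreg; rewrite -(t_div_logK F).
have := euler_fpsX; rewrite -{1}(t_div_logK F) fps_eulerM euler_log1p.
move=> /eqP; rewrite -subr_eq0 => /eqP e0.
apply/eqP; rewrite -subr_eq0; apply/eqP.
(* The bracket is E applied to T log(1+t) = t, hence 0. *)
transitivity (T * (fps_euler T * log1p + T * (X * fps_geom) - X)).
  by rewrite -(t_div_logK F); ring.
by rewrite e0 mulr0.
Qed.

(** Write the multiplier n as (n+1) - 1: the factor n+1 lowers the exponent k by one. *)
Lemma euler_Lif k : fps_euler (Lif F k) = Lif F (k - 1) - Lif F k.
Proof.
apply/fpsP => n; rewrite coefsD coefsN /= -polyC_natr -polyCM -polyCB.
have n1 : n.+1%:R != 0 :> F by rewrite pnatr_eq0.
have n0 : n`!%:R != 0 :> F by rewrite pnatr_eq0 -lt0n fact_gt0.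
congr _%:P; rewrite expfzDr // exprN1 !invfM invrK.
have -> : n%:R = n.+1%:R - 1 :> F by rewrite -natr1 addrK.
by rewrite mulrA; ring.
Qed.

Lemma euler_Lif_log k :
  fps_euler (LL k) = T * fps_geom * (LL (k - 1) - LL k).
Proof.
(* Writing t as T log(1+t) supplies the factor log(1+t) that the chain rule needs. *)
apply: fpsX_lreg; rewrite -{1}(t_div_logK F) -mulrA fps_euler_comp //.
rewrite euler_log1p euler_Lif.
have -> : fps_comp (Lif F (k - 1) - Lif F k) log1p = LL (k - 1) - LL k.
  apply/fpsP => n; rewrite coefsD coefsN /= -sumrB.
  by apply: eq_bigr => i _; rewrite mulrBl.
by ring.
Qed.

(** * The binomial series *)

Lemma coefs_pow1pS p n :
  n.+1%:R * coefs (P p) n.+1 = (p - n%:R) * coefs (P p) n.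
Proof.
rewrite /= big_ord_recr /= factS natrM invfM -polyC_natr mul_polyC.
by rewrite scalerA mulVKf ?pnatr_eq0 // -scalerAr mulrC.
Qed.

Lemma euler_pow1p p : fps_euler (P p) = P p * (fpsC p * (X * fps_geom)).
Proof.
(* Cleared of the denominator 1+t, the claim is the recurrence [coefs_pow1pS]. *)
suff eP : (1 + X) * fps_euler (P p) = X * (fpsC p * P p).
  transitivity ((1 + X) * fps_geom * fps_euler (P p)).
    by rewrite fps_geomP mul1r.
  by rewrite mulrAC eP; ring.
apply/fpsP => -[|n]; rewrite mulrDl mul1r coefsD ?coefs_fpsXM0.
  by rewrite /= mul0r addr0.
rewrite !coefs_fpsXM coefs_fpsCM.
have /= -> := coefs_pow1pS p n.
by rewrite mulrBl subrK.
Qed.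

Lemma fps_pow1pD1 p : P (p + 1) = (1 + X) * P p.
Proof.
apply/fpsP => -[|n]; rewrite mulrDl mul1r coefsD ?coefs_fpsXM0.
  by rewrite /= !big_ord0 addr0.
rewrite coefs_fpsXM.
have n1 : n.+1%:R != 0 :> {poly F} by rewrite -polyC_natr polyC_eq0 pnatr_eq0.
apply: (mulfI n1); rewrite mulrDr (coefs_pow1pS p) -mulrDl.
have -> : p - n%:R + n.+1%:R = p + 1 by rewrite -natr1 addrA subrK.
(* The first factor of the falling product at p+1 is p+1; the others form the falling product at
   p. *)
rewrite /= big_ord_recl subr0.
have -> : \prod_(i < n) (p + 1 - (lift ord0 i)%:R) = \prod_(i < n) (p - i%:R).
  by apply: eq_bigr => i _; rewrite lift0 -natr1; ring.
rewrite factS natrM invfM -[n.+1%:R]polyC_natr mul_polyC scalerA.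
by rewrite mulVKf ?pnatr_eq0 // scalerAr.
Qed.

(** * The shift x -> x+1 *)

Lemma shift_log1p : shift log1p = log1p.
Proof. by apply/fpsP => -[|n] /=; rewrite ?comp_poly0 ?comp_polyC. Qed.

Lemma shift_Lif k : shift (Lif F k) = Lif F k.
Proof. by apply/fpsP => n /=; rewrite comp_polyC. Qed.

Lemma shift_t_div_log : shift T = T.
Proof.
rewrite rmorphV ?fps_log1p_divX_unit //; congr _^-1.
by apply/fpsP => n /=; rewrite comp_polyC.
Qed.

Lemma shift_pow1p : shift (P 'X) = P ('X + 1).
Proof.
apply/fpsP => n /=; rewrite comp_polyZ rmorph_prod; congr (_ *: _).
by apply: eq_bigr => i _; rewrite rmorphB rmorph_nat /= comp_polyX.
Qed.

(** Only the factor (1+t)^-x involves x, and it becomes (1+t)^-x / (1+t). *)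
Lemma shift_Agf r k : shift (Agf F r k) = fps_geom * Agf F r k.
Proof.
rewrite /Agf !rmorphM /= fps_map_comp shift_Lif shift_log1p.
rewrite rmorphXz ?t_div_log_unit //= shift_t_div_log.
rewrite rmorphV ?fps_pow1p_unit //= shift_pow1p fps_pow1pD1.
have W : (1 + X) \is a GRing.unit.
  by apply/unitrP; exists fps_geom; rewrite mulrC fps_geomP.
rewrite invrM ?fps_pow1p_unit //.
have -> : (1 + X)^-1 = fps_geom by apply: (mulrI W); rewrite mulrV // fps_geomP.
by ring.
Qed.

(** * The differential equation of the generating function *)

Lemma euler_Agf r k :
  fps_euler (Agf F r k) =
    X * (- (fpsC 'X * shift (Agf F r k))
         + r%:~R * (fps_geom * (log1p_tail * Agf F (r + 1) k))
         + r%:~R * (fps_geom * Agf F r k))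
    + (shift (Agf F (r + 1) (k - 1)) - shift (Agf F (r + 1) k)).
Proof.
rewrite !shift_Agf /Agf exprzDr ?t_div_log_unit // expr1z.
rewrite !fps_eulerM euler_Lif_log.
rewrite (fps_euler_exprz _ t_div_log_unit euler_t_div_log).
rewrite (fps_euler_inv (fps_pow1p_unit _) (euler_pow1p 'X)).
(* The explicit factor t confines the r-terms to lower indices; the remaining T raises r to r+1. *)
have e : 1 - T * fps_geom = X * (fps_geom * (log1p_tail * T + 1)).
  transitivity ((1 + X) * fps_geom - T * fps_geom); first by rewrite fps_geomP.
  transitivity (fps_geom * (T * (1 + X * log1p_tail) + X - T)).
    by rewrite t_div_log_tail; ring.
  by ring.
by rewrite e; ring.
Qed.

(** * Extraction of coefficients *)

Lemma coefs_Apol r k n : coefs (Agf F r k) n = n`!%:R^-1 *: Apol r k n.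
Proof.
by rewrite /Apol scalerA mulVf ?scale1r // pnatr_eq0 -lt0n fact_gt0.
Qed.

(** Binomial convolution in mixed form: f is given by ordinary coefficients, g by exponential ones,
    so i! a_i stands for the exponential coefficients of f. *)
Lemma egf_coefsM (f g : S) (a : nat -> F) (b : nat -> {poly F}) n :
  (forall i, coefs f i = (a i)%:P) ->
  (forall i, coefs g i = i`!%:R^-1 *: b i) ->
  n`!%:R *: coefs (f * g) n =
    \sum_(0 <= l < n.+1) ((n - l)`!%:R * a (n - l)%N * 'C(n, l)%:R) *: b l.
Proof.
move=> fa gb; rewrite mulrC coefsM scaler_sumr big_mkord.
apply: eq_bigr => l _; rewrite fa gb mulrC mul_polyC !scalerA; congr (_ *: _).
have f0 m : m`!%:R != 0 :> F by rewrite pnatr_eq0 -lt0n fact_gt0.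
rewrite -(bin_fact (ltn_ord l : (l <= n)%N)) !natrM.
by field; rewrite f0.
Qed.

Lemma coefs_shift_Agf r k n :
  coefs (shift (Agf F r k)) n = n`!%:R^-1 *: (Apol r k n \Po ('X + 1)).
Proof. by rewrite -comp_polyZ -coefs_Apol. Qed.

Lemma coefs_geom n : coefs fps_geom n = ((-1) ^+ n)%:P.
Proof. by rewrite /= rmorphXn rmorphN1. Qed.

Lemma coefs_AgfS r k n :
  n.+1%:R * coefs (Agf F r k) n.+1 =
    - ('X * coefs (shift (Agf F r k)) n)
    + r%:~R * coefs (fps_geom * (log1p_tail * Agf F (r + 1) k)) n
    + r%:~R * coefs (fps_geom * Agf F r k) n
    + (coefs (shift (Agf F (r + 1) (k - 1))) n.+1
       - coefs (shift (Agf F (r + 1) k)) n.+1).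
Proof.
rewrite -coefs_euler euler_Agf coefsD coefs_fpsXM coefsD coefsD 2!coefsMrz.
by rewrite coefsN coefs_fpsCM.
Qed.

Lemma ApolS (r k : int) (n : nat) :
  Apol r k n.+1 =
    - ('X * (Apol r k n \Po ('X + 1)))
    + r%:~R * (\sum_(0 <= l < n.+1) \sum_(0 <= a < l.+1)
        ((-1) ^+ (n.+1 - a) * (((n - l)`! * (l - a)`!)%N%:R / (l - a + 2)%N%:R)
         * 'C(n, l)%:R * 'C(l, a)%:R) *: Apol (r + 1) k a)
    + r%:~R * (\sum_(0 <= l < n.+1)
        ((-1) ^+ (n.+1 - l - 1) * (n.+1 - l - 1)`!%:R * 'C(n, l)%:R)
        *: Apol r k l)
    + n.+1%:R^-1 *: ((Apol (r + 1) (k - 1) n.+1 \Po ('X + 1))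
                  - (Apol (r + 1) k n.+1 \Po ('X + 1))) :> {poly F}.
Proof.
have fact_neq0 i : i`!%:R != 0 :> F by rewrite pnatr_eq0 -lt0n fact_gt0.
(* Splitting (n+1)! as n! (n+1) leaves the coefficient of E G, and n! is the normalisation for the
   terms at index n. *)
have -> : Apol r k n.+1 = n`!%:R *: (n.+1%:R * coefs (Agf F r k) n.+1).
  by rewrite -polyC_natr mul_polyC scalerA mulrC -natrM -factS.
rewrite coefs_AgfS !coefs_shift_Agf -scalerBr.
rewrite scalerDr scalerDr scalerDr scalerN -scalerAr.
rewrite [n`!%:R *: (n`!%:R^-1 *: _)]scalerA mulfV // scale1r.
(* The last bracket carries no factor t and stays at index n+1, whence the 1/(n+1). *)
have n1E : n`!%:R / n.+1`!%:R = n.+1%:R^-1 :> F.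
  by rewrite factS natrM invfM mulrCA mulfV // mulr1.
rewrite [n`!%:R *: (n.+1`!%:R^-1 *: _)]scalerA n1E.
rewrite !(scalerAr _ r%:~R).
congr (- _ + _ * _ + _ * _ + _).
(* The double sum is two nested convolutions: the outer one with 1/(1+t), the inner one with u. *)
- rewrite (egf_coefsM (b := fun l => l`!%:R *: coefs
      (log1p_tail * Agf F (r + 1) k) l) _ coefs_geom) => [|i]; last first.
    by rewrite scalerA mulVf ?scale1r.
  rewrite !big_mkord; apply: eq_bigr => l _.
  rewrite (egf_coefsM (b := Apol (r + 1) k) _ coefs_log1p_tail (coefs_Apol _ _)).
  rewrite scaler_sumr !big_mkord; apply: eq_bigr => a _.
  rewrite scalerA; congr (_ *: _).
  have len : (l <= n)%N := ltn_ord l.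
  have lea : (a <= l)%N := ltn_ord a.
  (* The sign (-1)^(n-l) of 1/(1+t) meets the sign (-1)^(l-a+1) of u. *)
  have -> : (n.+1 - a = (n - l) + (l - a).+1)%N.
    by rewrite addnS subSn ?(leq_trans lea) // addnBA // subnK.
  by rewrite addn2 exprD natrM; ring.
- rewrite (egf_coefsM (b := Apol r k) _ coefs_geom (coefs_Apol _ _)).
  apply: eq_bigr => l _; rewrite subnAC subn1 /=; congr (_ *: _).
  by rewrite [_%:R * _]mulrC.
Qed.

End Agf.

Theorem theorem2p4 (R : realType) (r k : int) (n : nat) (hn : (1 <= n)%N) :
  (Apol r k n : {poly R[i]}) =
    - ('X * (Apol r k (n - 1) \Po ('X + 1)))
    + r%:~R * (\sum_(0 <= l < n) \sum_(0 <= a < l.+1)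
        ((-1) ^+ (n - a) * (((n - 1 - l)`! * (l - a)`!)%N%:R / (l - a + 2)%N%:R)
         * 'C(n - 1, l)%:R * 'C(l, a)%:R) *: Apol (r + 1) k a)
    + r%:~R * (\sum_(0 <= l < n)
        ((-1) ^+ (n - l - 1) * (n - l - 1)`!%:R * 'C(n - 1, l)%:R)
        *: Apol r k l)
    + n%:R^-1 *: ((Apol (r + 1) (k - 1) n \Po ('X + 1))
                  - (Apol (r + 1) k n \Po ('X + 1))).
Proof. by case: n hn => // n _; rewrite subn1 ApolS. Qed.
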